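(* Let $(c_n)_{n\ge 0}$ be i.i.d. random variables with values in $[0,1]$ (with an arbitrary distribution), independent of $r_0\sim\mathcal{U}(0,1)$. Define $r_{n+1}=T(c_n,r_n)$ and $\ell_{n+1}=\ell(c_n,r_n)$ for $n\ge 0$, with $T$ and $\ell$ as given in the context, and let $L_n=\prod_{i=1}^n\ell_i$ be the length of the $n$-th interval. Then, for all $n\ge 1$, $$\mathbb{E}[L_n]=\mathbb{E}[\ell_1]^n.$$
   Context: $\mathcal{U}(0,1)$ is the uniform distribution on $(0,1)$. For $c,r\in[0,1]$, $$T(c,r)=\begin{cases}\dfrac{r}{c} & \text{if } c\ge r,\\[2mm] \dfrac{r-c}{1-c} & \text{if } c<r,\end{cases}\qquad \ell(c,r)=\begin{cases} c & \text{if } c\ge r,\\ 1-c & \text{if } c<r,\end{cases}$$ with the convention $T(0,0)=0$. Here $r_n$ is the relative position of the root in the current interval (rescaled to $[0,1]$), $c_n$ the relative position of the random cut, and $\ell_{n+1}$ the factor by which the interval length is multiplied at that step; the initial interval has length $L_0=1$. *)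

(* Defs.v *)
From HB Require Import structures.
From mathcomp Require Import all_boot all_order all_algebra.
From mathcomp Require Import all_classical all_reals all_analysis.

Set Implicit Arguments.
Unset Strict Implicit.
Unset Printing Implicit Defensive.

Import Order.TTheory GRing.Theory Num.Theory.

Local Open Scope classical_set_scope.
Local Open Scope ring_scope.

(* T(0, 0) = 0 holds because 0 / 0 = 0; the case c < r only occurs with c < 1
   when r <= 1. *)
Definition root_map (R : realType) (c r : R) : R :=
  if r <= c then r / c else (r - c) / (1 - c).

Definition length_map (R : realType) (c r : R) : R :=
  if r <= c then c else 1 - c.

Fixpoint root_pos (R : realType) (c : nat -> R) (r0 : R) (n : nat) : R :=
  if n is m.+1 then root_map (c m) (root_pos c r0 m) else r0.

(* The factors are indexed from 1; the value at index 0 is irrelevant. *)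
Definition length_factor (R : realType) (c : nat -> R) (r0 : R) (n : nat) : R :=
  if n is m.+1 then length_map (c m) (root_pos c r0 m) else 1.

Definition interval_length (R : realType) (c : nat -> R) (r0 : R) (n : nat) : R :=
  \prod_(1 <= i < n.+1) length_factor c r0 i.

Definition mutually_independent d (T : measurableType d) (R : realType)
    (P : probability T R) (X : nat -> {RV P >-> R}) : Prop :=
  forall (J : seq nat) (A : nat -> set R), uniq J ->
    (forall j, measurable (A j)) ->
    P (\bigcap_(j in [set` J]) (X j @^-1` A j)) =
      (\prod_(j <- J) P (X j @^-1` A j))%E.

Definition identically_distributed d (T : measurableType d) (R : realType)
    (P : probability T R) (X : nat -> {RV P >-> R}) : Prop :=
  forall (n : nat) (A : set R), measurable A ->
    distribution P (X n) A = distribution P (X 0%N) A.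

Definition iid d (T : measurableType d) (R : realType)
    (P : probability T R) (X : nat -> {RV P >-> R}) : Prop :=
  mutually_independent X /\ identically_distributed X.

Definition sigma_of_seq d (T : measurableType d) (R : realType)
    (P : probability T R) (X : nat -> {RV P >-> R}) : set (set T) :=
  <<s \bigcup_n preimage_set_system setT (X n) measurable >>.

(* Independence from the whole process X, not merely from each X n. *)
Definition independent_of_seq d (T : measurableType d) (R : realType)
    (P : probability T R) (Y : {RV P >-> R}) (X : nat -> {RV P >-> R}) : Prop :=
  forall (A : set R) (B : set T), measurable A -> sigma_of_seq X B ->
    P (Y @^-1` A `&` B) = (P (Y @^-1` A) * P B)%E.

Definition uniform01 d (T : measurableType d) (R : realType)
    (P : probability T R) (Y : {RV P >-> R}) : Prop :=
  forall A : set R, measurable A ->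
    distribution P Y A = uniform_prob (@ltr01 R) A.

(* Main.v *)
Require Import Defs.
From HB Require Import structures.
From mathcomp Require Import all_boot all_order all_algebra.
From mathcomp Require Import all_classical all_reals all_analysis.
From mathcomp Require Import measurable_realfun ring.

(** The expected length factorizes because the relative position of the root
    forgets the past. For a fixed cut [c] and a uniform root, the root falls in
    the left part with probability [c] and in the right part with probability
    [1 - c]; given either part, the rescaled root is uniform again. So for every
    nonnegative measurable [g] the integral of [g (root_map c r)] weighted by
    [length_map c r] is [mean_factor c = c ^+ 2 + (1 - c) ^+ 2] times the
    integral of [g] ([ge0_integral_step]). Iterating this from the first cut on,
    the mean over the root of the [n]-th length, for a fixed sequence of cuts, is
    the product of the [mean_factor (c i)] for [i < n]
    ([integral_interval_length]).

    It remains to randomize the cuts. As the root is independent of the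
    sigma-algebra generated by the cuts, integrating over the root with the cuts
    fixed is legitimate by Tonelli ([ge0_integral_independent], used in
    [ge0_integral_indep_of_seq]). The mean of the product of the
    [mean_factor (c i)] is the product of their means because the cuts are
    independent ([integral_prod_indep]), and these means are equal because the
    cuts have the same law. Hence the mean of the [n]-th length is the [n]-th
    power of the mean of [mean_factor (c 0)], and the case [n = 1] identifies the
    latter with the mean of the first length factor. *)

Import Order.TTheory GRing.Theory Num.Theory numFieldNormedType.Exports.

Local Open Scope classical_set_scope.
Local Open Scope ring_scope.
Local Open Scope ereal_scope.

(** * Weighted image measures and independence *)

Section weighted.
Import HBNNSimple.

(** Both sides are additive and continuous from below in [g], so the hypothesis,
    which is the case of indicators, propagates to simple functions and then,
    by monotone convergence, to all nonnegative measurable functions. The weight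
    [w] serves to extract one factor from an integral of a product: the length
    factor of the first cut, and one factor among independent ones. *)
Lemma ge0_integral_weighted_pushforward (R : realType) d d'
    (T : measurableType d) (T' : measurableType d')
    (mu : {measure set T -> \bar R}) (nu : {measure set T' -> \bar R})
    (X : T -> T') (w : T -> R) (g : T' -> \bar R) :
  measurable_fun setT X -> measurable_fun setT w -> (forall x, 0 <= w x)%R ->
  measurable_fun [set: T'] g -> (forall y, 0 <= g y) ->
  (forall A, measurable A -> \int[mu]_(x in X @^-1` A) (w x)%:E = nu A) ->
  \int[mu]_x (g (X x) * (w x)%:E) = \int[nu]_y g y.
Proof.
move=> mX mw w0 mg g0 E.
pose h := nnsfun_approx measurableT mg.
have mE A : measurable A -> measurable (X @^-1` A).
  by move=> mA; rewrite -[X in measurable X]setTI; exact: mX.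
have hg y : (h n y)%:E @[n --> \oo] --> g y by exact: cvg_nnsfun_approx.
have ndh y : {homo (fun n => (h n y)%:E) : a b / (a <= b)%N >-> a <= b}.
  by move=> a b ab; rewrite lee_fin; exact/lefP/nd_nnsfun_approx.
have mhX n : measurable_fun setT (fun x => (h n (X x))%:E * (w x)%:E).
  apply: emeasurable_funM; last exact/measurable_EFinP.
  by apply/measurable_EFinP; exact: measurableT_comp.
transitivity (limn (fun n => \int[mu]_x ((h n (X x))%:E * (w x)%:E))).
  rewrite -monotone_convergence//.
  - apply: eq_integral => x _; apply/esym/cvg_lim => //.
    by apply: cvgeZr => //; exact: hg.
  - by move=> n x _; rewrite mule_ge0 ?lee_fin.
  - by move=> x _ a b ab; rewrite lee_wpmul2r ?lee_fin// -lee_fin ndh.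
transitivity (limn (fun n => \int[nu]_y (h n y)%:E)); last first.
  rewrite -monotone_convergence//.
  - by apply: eq_integral => y _; exact/cvg_lim.
  - by move=> n; exact/measurable_EFinP.
  - by move=> n y _; rewrite lee_fin.
congr (limn _); apply/funext => n.
transitivity (\int[mu]_x (\sum_(y \in range (h n))
    (y * \1_(h n @^-1` [set y]) (X x))%:E * (w x)%:E)).
  apply: eq_integral => x _.
  rewrite -ge0_mule_fsuml => [|y]; last exact: nnfun_muleindic_ge0.
  by rewrite fsumEFin// -fimfunE.
transitivity (\int[nu]_x (\sum_(y \in range (h n))
    (y * \1_(h n @^-1` [set y]) x)%:E)); last first.
  by apply: eq_integral => t _; rewrite /= fimfunE -fsumEFin.
have mi y : measurable_fun setT (fun x => (y * \1_(h n @^-1` [set y]) x)%:E).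
  by apply/measurable_EFinP; exact: measurable_funM.
rewrite ge0_integral_fsum//; last 2 first.
- move=> y; apply: emeasurable_funM; last exact/measurable_EFinP.
  exact: (measurableT_comp (mi y)).
- move=> y x _; apply: mule_ge0; last by rewrite lee_fin.
  exact: nnfun_muleindic_ge0.
rewrite ge0_integral_fsum//; last by move=> y x _; exact: nnfun_muleindic_ge0.
apply: eq_fsbigr => r rh.
have r0 : (0 <= r)%R by move: rh; rewrite inE => -[t _ <-].
rewrite integralZl_indic_nnsfun// integral_indic// setIT -E//.
under eq_integral do rewrite EFinM -muleA.
rewrite ge0_integralZl//; last 2 first.
- apply: emeasurable_funM; last exact/measurable_EFinP.
  by apply/measurable_EFinP; exact: measurableT_comp.
- by move=> x _; rewrite mule_ge0// lee_fin.
congr (_ * _); rewrite [RHS]integral_mkcond; apply: eq_integral => x _.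
rewrite patchE indicE.
have -> : (x \in X @^-1` (h n @^-1` [set r])) = (X x \in h n @^-1` [set r]).
  by apply/idP/idP; rewrite !inE.
by case: ifPn => _; rewrite ?mul1e ?mul0e.
Qed.
End weighted.

(** Independence says that the joint law of [Y] and [Z] agrees with the product
    law on rectangles, hence everywhere, and Tonelli applies. The law of [Z] is
    transported back to the sample space in the outer integral, so that [Z] may
    be the identity map to a coarser sigma-algebra. *)
Lemma ge0_integral_independent (R : realType) d d1 d2 (T : measurableType d)
    (T1 : measurableType d1) (T2 : measurableType d2) (P : probability T R)
    (Y : {mfun T >-> T1}) (Z : {mfun T >-> T2}) (f : T1 * T2 -> \bar R) :
  (forall A B, measurable A -> measurable B ->
     P (Y @^-1` A `&` Z @^-1` B) = P (Y @^-1` A) * P (Z @^-1` B)) ->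
  measurable_fun setT f -> (forall z, 0 <= f z) ->
  \int[P]_t f (Y t, Z t) = \int[P]_t \int[distribution P Y]_y f (y, Z t).
Proof.
move=> indep mf f0.
have mYZ : measurable_fun setT (fun t => (Y t, Z t)).
  by apply: measurable_fun_pair.
transitivity (\int[distribution P Y \x distribution P Z]_z f z).
  rewrite -[LHS](@ge0_integral_pushforward _ _ _ _ _ _ mYZ P setT f)//.
  by apply: eq_measure_integral => A mA _; apply/esym/product_measure_unique.
rewrite fubini_tonelli2//.
rewrite ge0_integral_distribution//.
- exact: (measurable_fun_fubini_tonelli_G (m1 := distribution P Y)).
- by move=> z; exact: integral_ge0.
Qed.

(** * The uniform measure under affine maps *)

Lemma lebesgue_measure_affine_preimage (R : realType) (s t : R) (A : set R) :
  (0 < s)%R -> measurable A ->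
  lebesgue_measure ((fun x => (x - t) / s)%R @^-1` A) =
  s%:E * lebesgue_measure A.
Proof.
move=> s0 mA.
pose h (x : R) : measurableTypeR R := ((x - t) / s)%R.
have mh : measurable_fun setT h.
  by apply: measurable_funM => //; exact: measurable_funB.
pose si : {nonneg R} := NngNum (ltW (etrans (invr_gt0 s) s0)).
have -> : lebesgue_measure A = pushforward (mscale si lebesgue_measure) h A.
  apply: lebesgue_measure_unique => // _ [[a b]] _ <-.
  transitivity (s^-1%:E * lebesgue_measure (h @^-1` `]a, b]%classic)) => //.
  have -> : h @^-1` `]a, b] = `](s * a + t)%R, (s * b + t)%R]%classic.
    apply/seteqP; split => x /=; rewrite !in_itv/= /h ltr_pdivlMr// ler_pdivrMr//;
      by rewrite ltrBrDr lerBlDr ![(s * _)%R]mulrC.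
  rewrite !lebesgue_measure_itv/= !lte_fin ltrD2r ltr_pM2l//.
  case: ifPn => // _; last by rewrite mule0.
  rewrite -!EFinB -EFinM; congr EFin; field; exact: lt0r_neq0.
rewrite /pushforward /mscale/= muleA -EFinM divff ?mul1e//; exact: lt0r_neq0.
Qed.

(** The half-open interval is chosen so that a cut at [c] divides it exactly into
    the intervals from [0] to [c] and from [c] to [1], both of the same
    half-open shape, with [c] itself on the left as in [root_map]. *)
Lemma uniform01_lebesgue (R : realType) (A : set R) : measurable A ->
  uniform_prob (@ltr01 R) A = lebesgue_measure (A `&` `]0%R, 1%R]).
Proof.
move=> mA.
rewrite /uniform_prob integral_uniform_pdf.
rewrite (eq_integral (cst 1)); last first.
  move=> x; rewrite inE/= in_itv/= => -[_ x01].
  by rewrite /uniform_pdf x01 subr0 invr1.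
rewrite integral_cst/=; last exact: measurableI.
rewrite mul1e.
apply/eqP; rewrite eq_le; apply/andP; split; last first.
  apply: le_measure; rewrite ?inE; try exact: measurableI.
  by apply: setIS; apply: subset_itvr; rewrite bnd_simp.
apply: (@le_trans _ _ (lebesgue_measure ((A `&` `]0%R, 1%R]) `|` [set 0%R]))).
  apply: le_measure; rewrite ?inE; first exact: measurableI.
    by apply: measurableU => //; exact: measurableI.
  move=> x [Ax]; rewrite /= !in_itv/= => /andP[x0 x1].
  have [->|xn0] := eqVneq x 0%R; [by right|left].
  by split => //; rewrite lt_neqAle eq_sym xn0 x0.
apply: le_trans (measureU2 _ _ _) _ => //; first exact: measurableI.
by rewrite [X in _ + X](lebesgue_measure_set1 0%R) adde0.
Qed.

(** * Cutting at fixed positions *)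

Section maps.
Context {R : realType}.
Implicit Types c r : R.

Lemma length_map_ge0 c r : (0 <= c <= 1)%R -> (0 <= length_map c r)%R.
Proof.
by move=> /andP[? ?]; rewrite /length_map; case: ifP; rewrite ?subr_ge0.
Qed.

Lemma measurable_length_map d (T : measurableType d) (f g : T -> R) :
  measurable_fun setT f -> measurable_fun setT g ->
  measurable_fun setT (fun x => length_map (f x) (g x)).
Proof.
move=> mf mg; apply: measurable_fun_ifT => //; first exact: measurable_fun_ler.
exact: measurable_funB.
Qed.

Lemma measurable_inv : measurable_fun [set: R] (fun x : R => x^-1)%R.
Proof.
rewrite -(setvU [set 0%R]); apply/measurable_funU => //; first exact: measurableC.
split; last exact: measurable_fun_set1.
rewrite (_ : ~` _ = [set x | x != 0%R]); last first.
  by apply/seteqP; split => x /= /eqP.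
apply: open_continuous_measurable_fun; first exact: open_neq.
by move=> x; rewrite inE/= => x0; exact: inv_continuous.
Qed.

Lemma measurable_root_map d (T : measurableType d) (f g : T -> R) :
  measurable_fun setT f -> measurable_fun setT g ->
  measurable_fun setT (fun x => root_map (f x) (g x)).
Proof.
have mV (h : T -> R) : measurable_fun setT h ->
    measurable_fun setT (fun x : T => ((h x)^-1)%R).
  by move=> mh; exact: measurableT_comp measurable_inv mh.
move=> mf mg; apply: measurable_fun_ifT; first exact: measurable_fun_ler.
- by apply: measurable_funM => //; exact: mV.
- apply: measurable_funM; first exact: measurable_funB.
  by apply: mV; exact: measurable_funB.
Qed.

Lemma measurable_root_pos d (T : measurableType d) (c : nat -> T -> R)
    (f : T -> R) n : (forall k, measurable_fun setT (c k)) ->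
  measurable_fun setT f ->
  measurable_fun setT (fun x => root_pos (c ^~ x) (f x) n).
Proof.
by move=> mc mf; elim: n => //= n IH; exact: measurable_root_map.
Qed.

Lemma measurable_interval_length d (T : measurableType d) (c : nat -> T -> R)
    (f : T -> R) n : (forall k, measurable_fun setT (c k)) ->
  measurable_fun setT f ->
  measurable_fun setT (fun x => interval_length (c ^~ x) (f x) n).
Proof.
move=> mc mf; apply: measurable_prod => -[|i] _ //=.
by apply: measurable_length_map => //; exact: measurable_root_pos.
Qed.

Lemma interval_length_ge0 (c : nat -> R) r n :
  (forall k, 0 <= c k <= 1)%R -> (0 <= interval_length c r n)%R.
Proof. by move=> c01; apply: prodr_ge0 => -[|i] _ //=; exact: length_map_ge0. Qed.

Lemma root_posS (c : nat -> R) r n :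
  root_pos c r n.+1 = root_pos (fun k => c k.+1) (root_map (c 0%N) r) n.
Proof. by elim: n => //= n <-. Qed.

(** Decomposition by the first cut, not the last: the rest of the process is the
    same process with shifted cuts, started from the new position of the root,
    which is the form that [ge0_integral_step] needs. *)
Lemma interval_lengthS (c : nat -> R) r n :
  interval_length c r n.+1 =
  (length_map (c 0) r *
   interval_length (fun k => c k.+1) (root_map (c 0%N) r) n)%R.
Proof.
rewrite /interval_length big_nat_recl//=; congr *%R.
rewrite big_add1/= [RHS]big_add1/=.
apply: eq_bigr => i _.
exact: (congr1 (length_map (c i.+1)) (root_posS c r i)).
Qed.

(** For a root uniform on the unit interval, the mean of [length_map c]: the
    left part is chosen with probability [c] and has length [c], and the right
    part is chosen with probability [1 - c] and has length [1 - c]. *)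
Definition mean_factor c : R := (c ^+ 2 + (1 - c) ^+ 2)%R.

Lemma mean_factor_ge0 c : (0 <= mean_factor c)%R.
Proof. by rewrite addr_ge0// sqr_ge0. Qed.

(** On the left of the cut, [root_map c] is the dilation of ratio [c^-1], which
    maps the interval from [0] to [c] onto the unit interval. *)
Lemma lebesgue_left c (A : set R) : (0 < c)%R -> measurable A ->
  lebesgue_measure [set r | A (root_map c r) /\ (0 < r <= c)%R] =
  c%:E * uniform_prob (@ltr01 R) A.
Proof.
move=> c0 mA.
rewrite uniform01_lebesgue// -(@lebesgue_measure_affine_preimage _ c 0)//.
  congr (lebesgue_measure _); apply/seteqP; split => r /=.
    move=> [Ar /andP[r0 rc]].
    rewrite subr0 in_itv/= divr_gt0// ler_pdivrMr// mul1r rc.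
    by split => //; move: Ar; rewrite /root_map rc.
  rewrite subr0 in_itv/= pmulr_lgt0 ?invr_gt0// ler_pdivrMr// mul1r.
  by move=> [Ar /andP[-> rc]]; rewrite /root_map rc.
exact: measurableI.
Qed.

(** On the right of the cut, [root_map c] is the increasing affine bijection to
    the unit interval, of slope [(1 - c)^-1]. *)
Lemma lebesgue_right c (A : set R) : (c < 1)%R -> measurable A ->
  lebesgue_measure [set r | A (root_map c r) /\ (c < r <= 1)%R] =
  (1 - c)%:E * uniform_prob (@ltr01 R) A.
Proof.
move=> c1 mA; have c10 : (0 < 1 - c)%R by rewrite subr_gt0.
rewrite uniform01_lebesgue// -(@lebesgue_measure_affine_preimage _ (1 - c) c)//.
  congr (lebesgue_measure _); apply/seteqP; split => r /=.
    move=> [Ar /andP[cr r1]]; rewrite in_itv/= divr_gt0 ?subr_gt0//.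
    rewrite ler_pdivrMr// mul1r lerD2r r1; split => //.
    by move: Ar; rewrite /root_map leNgt cr.
  rewrite in_itv/= pmulr_lgt0 ?invr_gt0// subr_gt0 ler_pdivrMr// mul1r lerD2r.
  by move=> [Ar /andP[cr ->]]; rewrite cr /root_map leNgt cr.
exact: measurableI.
Qed.

(** Each side of the cut contributes a length factor times a measure that is the
    same factor times the uniform one, hence the squares in [mean_factor]. *)
Lemma integral_length_map_preimage c (A : set R) :
  (0 <= c <= 1)%R -> measurable A ->
  \int[uniform_prob (@ltr01 R)]_(r in root_map c @^-1` A) (length_map c r)%:E =
  (mean_factor c)%:E * uniform_prob (@ltr01 R) A.
Proof.
move=> c01 mA; have /andP[c0 c1] := c01.
set D := root_map c @^-1` A.
have mD : measurable D.
  by rewrite -[D]setTI; apply: measurable_root_map.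
have mw : measurable_fun setT (fun r => (length_map c r)%:E).
  by apply/measurable_EFinP; exact: measurable_length_map.
have w0 r : 0 <= (length_map c r)%:E by rewrite lee_fin length_map_ge0.
rewrite integral_mkcond integral_uniform; last 2 first.
- apply/(measurable_restrictT _ _).1 => //; exact: measurable_funTS.
- by move=> r; exact: erestrict_ge0.
rewrite subr0 invr1 mul1e -integral_itv_obnd_cbnd -?integral_mkcondr; last first.
  apply/measurable_funTS/(measurable_restrictT _ _).1 => //.
  exact: measurable_funTS.
have UE : `]0%R, 1%R]%classic `&` D =
    [set r | A (root_map c r) /\ (0 < r <= c)%R] `|`
    [set r | A (root_map c r) /\ (c < r <= 1)%R].
  apply/seteqP; split => r /=; rewrite in_itv/=.
    move=> [/andP[r0 r1] Ar]; have [rc|cr] := leP r c; [left|right]; split => //.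
    by rewrite r0.
  case=> -[Ar /andP[]] => [r0 rc|cr r1]; split => //.
    by rewrite r0 (le_trans rc).
  by rewrite r1 (le_lt_trans c0).
have mL : measurable [set r | A (root_map c r) /\ (0 < r <= c)%R].
  rewrite (_ : mkset _ = D `&` `]0%R, c]%classic); first exact: measurableI.
  by apply/seteqP; split => r /=; rewrite in_itv.
have mR : measurable [set r | A (root_map c r) /\ (c < r <= 1)%R].
  rewrite (_ : mkset _ = D `&` `]c, 1%R]%classic); first exact: measurableI.
  by apply/seteqP; split => r /=; rewrite in_itv.
rewrite UE ge0_integral_setU//=; last 2 first.
- exact: measurable_funTS.
- apply/disj_setPS => r /= [[_ /andP[_ rc]] [_ /andP[cr _]]].
  by move: (lt_le_trans cr rc); rewrite ltxx.
under eq_integral.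
  move=> r; rewrite inE/= => -[_ /andP[_ rc]]; rewrite /length_map rc.
  over.
under [X in _ + X]eq_integral.
  move=> r; rewrite inE/= => -[_ /andP[cr _]]; rewrite /length_map leNgt cr.
  over.
rewrite !integral_cst//=.
have -> : c%:E *
    lebesgue_measure [set r | A (root_map c r) /\ (0 < r <= c)%R] =
    (c ^+ 2)%:E * uniform_prob (@ltr01 R) A.
  (* For c = 0 the dilation degenerates, but the length factor vanishes. *)
  have [->|cn0] := eqVneq c 0%R; first by rewrite expr0n/= !mul0e.
  by rewrite lebesgue_left// ?lt_neqAle 1?eq_sym ?cn0// muleA -EFinM expr2.
have -> : (1 - c)%:E *
    lebesgue_measure [set r | A (root_map c r) /\ (c < r <= 1)%R] =
    ((1 - c) ^+ 2)%:E * uniform_prob (@ltr01 R) A.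
  have [->|cn1] := eqVneq c 1%R; first by rewrite subrr expr0n/= !mul0e.
  by rewrite lebesgue_right// ?lt_neqAle ?cn1// muleA -EFinM expr2.
by rewrite -ge0_muleDl// ?lee_fin ?sqr_ge0.
Qed.

(** The heart of the matter: after one step, conditionally on the part that
    contains it, the rescaled root is again uniform, whichever part this is. It
    is therefore independent of the length factor of the step. *)
Lemma ge0_integral_step c (g : R -> \bar R) : (0 <= c <= 1)%R ->
  measurable_fun setT g -> (forall r, 0 <= g r) ->
  \int[uniform_prob (@ltr01 R)]_r (g (root_map c r) * (length_map c r)%:E) =
  (mean_factor c)%:E * \int[uniform_prob (@ltr01 R)]_r g r.
Proof.
move=> c01 mg g0.
pose k : {nonneg R} := NngNum (mean_factor_ge0 c).
rewrite -[RHS](@ge0_integral_mscale _ _ _ _ setT _ k)//.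
apply: ge0_integral_weighted_pushforward => //.
- exact: measurable_root_map.
- exact: measurable_length_map.
- by move=> r; exact: length_map_ge0.
- by move=> A mA; exact: integral_length_map_preimage.
Qed.

Lemma integral_interval_length (c : nat -> R) n : (forall k, 0 <= c k <= 1)%R ->
  \int[uniform_prob (@ltr01 R)]_r (interval_length c r n)%:E =
  (\prod_(i < n) mean_factor (c i))%:E.
Proof.
elim: n c => [|n IH] c c01.
  under eq_integral do rewrite /interval_length big_geq//.
  by rewrite integral_cst// mul1e big_ord0; exact: probability_setT.
under eq_integral do rewrite interval_lengthS mulrC EFinM.
rewrite (@ge0_integral_step (c 0%N)
  (fun r => (interval_length (fun k => c k.+1) r n)%:E))//.
- by rewrite IH// big_ord_recl EFinM.
- apply/measurable_EFinP.
  exact: (@measurable_interval_length _ _ (fun k _ => c k.+1)).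
- by move=> r; rewrite lee_fin interval_length_ge0.
Qed.

End maps.

(** * Products of independent variables *)

Section independence.
Context d (Omega : measurableType d) (R : realType) (P : probability Omega R).
Context (X : nat -> {RV P >-> R}) (X_indep : mutually_independent X).
Context (phi : nat -> R -> R) (mphi : forall k, measurable_fun setT (phi k))
  (phi0 : forall k x, (0 <= phi k x)%R)
  (phi_fin : forall k, \int[P]_w (phi k (X k w))%:E \is a fin_num).

(** Integrating over an intersection of events of the family, instead of over
    the whole space, is what makes the induction on [ks] go through without any
    monotone-class argument. To pull out the factor of index [k], it suffices
    by [ge0_integral_weighted_pushforward] to treat indicators of [X k], and
    these are absorbed in the domain: the index [k] moves from [ks] to [js].
    When [ks] is empty, the statement is the definition of independence. *)
Lemma integral_prod_indep_on (ks js : seq nat) (A : nat -> set R) :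
  uniq (ks ++ js) -> (forall j, measurable (A j)) ->
  \int[P]_(w in \bigcap_(j in [set` js]) (X j @^-1` A j))
      (\prod_(k <- ks) phi k (X k w))%:E =
  (\prod_(k <- ks) \int[P]_w (phi k (X k w))%:E) *
  \prod_(j <- js) P (X j @^-1` A j).
Proof.
have mX j B : measurable B -> measurable (X j @^-1` B).
  by move=> mB; rewrite -[X in measurable X]setTI; exact: measurable_funPT.
have mcap s B : (forall j, measurable (B j)) ->
    measurable (\bigcap_(j in [set` s]) (X j @^-1` B j)).
  by move=> mB; apply: bigcap_measurableType => // j _; exact: mX.
elim: ks js A => [|k ks IH] js A.
  move=> /= ujs mA; under eq_integral do rewrite big_nil.
  by rewrite big_nil integral_cst; [rewrite !mul1e; exact: X_indep | exact: mcap].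
move=> /= /andP[kks uks] mA.
set D := \bigcap_(j in _) _.
have mD : measurable D by exact: mcap.
set W := fun w => (\prod_(k <- ks) phi k (X k w) * \1_D w)%R.
have mprod s : measurable_fun setT (fun w => \prod_(k <- s) phi k (X k w))%R.
  by apply: measurable_prod => i _; exact: measurableT_comp.
have prod0 s w : (0 <= \prod_(k <- s) phi k (X k w))%R by exact: prodr_ge0.
set E : \bar R := \prod_(k <- ks) \int[P]_w (phi k (X k w))%:E *
   \prod_(j <- js) P (X j @^-1` A j).
have E0 : 0 <= E.
  rewrite mule_ge0// prode_ge0// => i _.
  by apply: integral_ge0 => w _; rewrite lee_fin.
have Efin : E \is a fin_num.
  rewrite fin_numM//; apply: prode_fin_num => // j _.
  by rewrite fin_num_measure//; exact: mX.
pose m : {nonneg R} := NngNum (fine_ge0 E0).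
have mE : m%:num%:E = E by rewrite fineK.
have mphiE : measurable_fun setT (EFin \o phi k) by exact/measurable_EFinP.
have phiE0 x : 0 <= (EFin \o phi k) x by rewrite lee_fin.
(* The event D becomes part of the weight W. *)
transitivity (\int[P]_w ((phi k (X k w))%:E * (W w)%:E)).
  rewrite integral_mkcond; apply: eq_integral => w _.
  rewrite patchE /W indicE big_cons; case: ifPn => _.
    by rewrite mulr1 EFinM.
  by rewrite mulr0 mule0.
rewrite (@ge0_integral_weighted_pushforward _ _ _ _ _ P
    (mscale m (distribution P (X k))) (X k) W (EFin \o phi k))//.
- rewrite ge0_integral_mscale// ge0_integral_distribution//.
  by rewrite mE /E big_cons -[RHS]muleA [LHS]muleC.
- by rewrite /W; apply: measurable_funM => //; exact: measurable_indic.
- by move=> w; rewrite mulr_ge0.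
move=> B mB.
pose A' j := if j == k then B else A j.
have mA' j : measurable (A' j) by rewrite /A'; case: ifP.
have kjs : k \notin js by move: kks; rewrite mem_cat negb_or => /andP[].
have uks' : uniq (ks ++ k :: js).
  by rewrite -cat1s uniq_catCA cat1s /= kks uks.
have A'js j : j \in js -> A' j = A j.
  by move=> jjs; rewrite /A'; case: eqP => // jk; rewrite -jk jjs in kjs.
have DE : \bigcap_(j in [set` k :: js]) (X j @^-1` A' j) = X k @^-1` B `&` D.
  apply/seteqP; split => w /=.
    move=> H; split.
      by have := H k; rewrite /= /A' eqxx; apply; rewrite inE eqxx.
    move=> j /= jjs; rewrite -A'js//; apply: H.
    by rewrite /= inE jjs orbT.
  move=> [Bw Dw] j /=; rewrite inE => /predU1P[->|jjs].
    by rewrite /A' eqxx.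
  by rewrite A'js//; exact: Dw.
transitivity (\int[P]_(w in X k @^-1` B `&` D)
                 (\prod_(k <- ks) phi k (X k w))%:E).
  rewrite integral_mkcondr; apply: eq_integral => w _.
  rewrite patchE /W indicE; case: ifPn => _.
    by rewrite mulr1.
  by rewrite mulr0.
rewrite -DE IH// big_cons /= /mscale/= mE /E.
have -> : \prod_(j <- js) P (X j @^-1` A' j) =
          \prod_(j <- js) P (X j @^-1` A j).
  by apply: eq_big_seq => j jjs; rewrite A'js.
have -> : A' k = B by rewrite /A' eqxx.
by rewrite muleCA [LHS]muleC.
Qed.

Lemma integral_prod_indep (ks : seq nat) : uniq ks ->
  \int[P]_w (\prod_(k <- ks) phi k (X k w))%:E =
  \prod_(k <- ks) \int[P]_w (phi k (X k w))%:E.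
Proof.
move=> uks.
have := @integral_prod_indep_on ks [::] (fun=> setT).
rewrite cats0 big_nil mule1 => <-//.
by rewrite set_nil bigcap_set0.
Qed.

End independence.

(** * Random cuts *)

Section process.
Context d (Omega : measurableType d) (R : realType) (P : probability Omega R).
Context (c : nat -> {RV P >-> R}) (r0 : {RV P >-> R}).

Let cut_events := \bigcup_n
  preimage_set_system setT (c n) (@measurable _ R).
Let OmegaC := g_sigma_algebraType cut_events.

Lemma sub_sigma_of_seq (B : set Omega) : sigma_of_seq c B -> measurable B.
Proof.
apply: (@smallest_sub _ (sigma_algebra setT) cut_events measurable).
  exact: sigma_algebra_measurable.
by move=> _ [n _ [A mA <-]]; exact: measurable_funPT.
Qed.

(** The whole sequence of cuts is encoded by the identity map to [OmegaC], which
    dispenses with a measurable structure on sequences of reals: a function that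
    depends on the sample point only through the cuts is one that is measurable
    on [OmegaC]. *)
Lemma ge0_integral_indep_of_seq (f : R * OmegaC -> \bar R) :
  independent_of_seq r0 c ->
  measurable_fun setT f -> (forall z, 0 <= f z) ->
  \int[P]_w f (r0 w, w) = \int[P]_w \int[distribution P r0]_r f (r, w).
Proof.
move=> indep mf f0.
have mid : measurable_fun [set: Omega] (id : Omega -> OmegaC).
  by move=> _ B mB; rewrite setTI; exact: sub_sigma_of_seq.
pose idC : {mfun Omega >-> OmegaC} := HB.pack (id : Omega -> OmegaC)
  (isMeasurableFun.Build _ _ _ _ _ mid).
by apply: (@ge0_integral_independent _ _ _ _ _ _ _ P r0 idC).
Qed.

Lemma measurable_cut n : measurable_fun [set: OmegaC] (c n : OmegaC -> R).
Proof.
move=> _ B mB; rewrite setTI; apply: sub_sigma_algebra.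
by exists n => //; exists B => //; rewrite setTI.
Qed.

Context (c01 : forall k w, (0 <= c k w <= 1)%R) (c_iid : iid c)
  (r0_uniform : uniform01 r0) (r0_indep : independent_of_seq r0 c).

(** The law of [r0] and [uniform_prob] live on two measurable structures on [R]
    that have the same measurable sets; transporting by the identity relates the
    two integrals. *)
Lemma ge0_integral_uniform01_distribution (g : R -> \bar R) :
  measurable_fun setT g -> (forall r, 0 <= g r) ->
  \int[distribution P r0]_r g r = \int[uniform_prob (@ltr01 R)]_r g r.
Proof.
move=> mg g0.
have mid : measurable_fun [set: R] (id : R -> measurableTypeR R).
  by move=> _ B mB; rewrite setTI.
rewrite -[LHS](@ge0_integral_pushforward _ _ _ _ _ _ mid
  (distribution P r0) setT g)//.
by apply: eq_measure_integral => A mA _; exact: r0_uniform.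
Qed.

Lemma integral_interval_length_iid n :
  \int[P]_w (interval_length (fun k => c k w) (r0 w) n)%:E =
  (\int[P]_w (mean_factor (c 0%N w))%:E) ^+ n.
Proof.
have [c_indep c_id] := c_iid.
have mm : measurable_fun setT (@mean_factor R).
  apply: measurable_funD; apply: measurable_funX => //.
  exact: measurable_funB.
have mfE : measurable_fun setT (EFin \o @mean_factor R).
  exact/measurable_EFinP.
have same k : \int[P]_w (mean_factor (c k w))%:E =
              \int[P]_w (mean_factor (c 0%N w))%:E.
  rewrite -[LHS](@ge0_integral_distribution _ _ _ _ _ P (c k)
    (EFin \o @mean_factor R))//; last by move=> x; rewrite lee_fin mean_factor_ge0.
  rewrite -[RHS](@ge0_integral_distribution _ _ _ _ _ P (c 0%N)
    (EFin \o @mean_factor R))//; last by move=> x; rewrite lee_fin mean_factor_ge0.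
  by apply: eq_measure_integral => A mA _; exact: c_id.
have fin k : \int[P]_w (mean_factor (c k w))%:E \is a fin_num.
  rewrite ge0_fin_numE; last first.
    by apply: integral_ge0 => w _; rewrite lee_fin mean_factor_ge0.
  apply: (@le_lt_trans _ _ (\int[P]_w (cst 2%:E w))).
    apply: ge0_le_integral => //.
    - by move=> w _; rewrite lee_fin mean_factor_ge0.
    - by apply/measurable_EFinP; exact: measurableT_comp.
    - move=> w _; rewrite lee_fin /mean_factor.
      have /andP[c0 c1] := c01 k w.
      rewrite -[leRHS]/(1 + 1)%R lerD// expr_le1// ?subr_ge0//.
      by rewrite gerBl.
  rewrite integral_cst// [X in _ * X](_ : _ = 1) ?mule1 ?ltry//.
  exact: probability_setT.
transitivity (\int[P]_w (\prod_(i < n) mean_factor (c i w))%:E).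
  rewrite (@ge0_integral_indep_of_seq
    (fun z => (interval_length (fun k => c k z.2) z.1 n)%:E))//; last 2 first.
  - apply/measurable_EFinP.
    apply: (@measurable_interval_length R _ (measurableTypeR R * OmegaC)%type
      (fun k z => c k z.2) fst) => // k.
    exact: (measurableT_comp (measurable_cut k)).
  - by move=> z; rewrite lee_fin interval_length_ge0.
  apply: eq_integral => w _.
  rewrite -(@integral_interval_length _ (c ^~ w))//.
  apply: ge0_integral_uniform01_distribution.
    apply/measurable_EFinP.
    exact: (@measurable_interval_length R _ R (fun k _ => c k w) id).
  by move=> r; rewrite lee_fin interval_length_ge0.
under eq_integral do rewrite -(big_mkord xpredT (fun i => mean_factor (c i _))).
rewrite (@integral_prod_indep _ _ _ _ _ c_indep (fun=> @mean_factor R)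
  (fun=> mm) (fun=> mean_factor_ge0))//; last first.
  exact: iota_uniq.
rewrite (eq_bigr (fun=> \int[P]_w (mean_factor (c 0%N w))%:E))//.
elim: n => [|n IH]; first by rewrite big_geq.
by rewrite big_nat_recr// expeS IH muleC.
Qed.
End process.

Theorem corollary9 (d : measure_display) (Omega : measurableType d)
    (R : realType) (P : probability Omega R)
    (c : nat -> {RV P >-> R}) (r0 : {RV P >-> R})
    (c01 : forall (k : nat) (w : Omega), (0 <= c k w <= 1)%R)
    (c_iid : iid c)
    (r0_uniform : uniform01 r0)
    (r0_indep : independent_of_seq r0 c)
    (n : nat) (n_ge1 : (1 <= n)%N) :
  'E_P[fun w => interval_length (fun k => c k w) (r0 w) n] =
  'E_P[fun w => length_factor (fun k => c k w) (r0 w) 1] ^+ n.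
Proof.
have E1 : 'E_P[fun w => length_factor (fun k => c k w) (r0 w) 1] =
    \int[P]_w (interval_length (fun k => c k w) (r0 w) 1)%:E.
  (* The first factor is the length of the first interval. *)
  rewrite unlock; apply: eq_integral => w _.
  by rewrite /interval_length big_nat1.
by rewrite E1 unlock !integral_interval_length_iid// expe1.
Qed.
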